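(* Each coarse map $f\colon(X,\xi)\to(Y,\eta)$ of pointed coarse spaces functorially induces a bornologous map $S(f)\colon S(X,\xi)\to S(Y,\eta)$ by $S(f)(s):=f\circ s$. That is, $S(f)$ is well defined (i.e. $f\circ s\in S(Y,\eta)$ for $s\in S(X,\xi)$) and bornologous, $S(\mathrm{id}_{(X,\xi)})=\mathrm{id}_{S(X,\xi)}$, and $S(g\circ f)=S(g)\circ S(f)$ for all coarse maps $f\colon(X,\xi)\to(Y,\eta)$ and $g\colon(Y,\eta)\to(Z,\zeta)$ of pointed coarse spaces.
   Context: For binary relations $E,F\subseteq X\times X$: $E\circ F=\{(x,y) : (x,z)\in E \text{ and } (z,y)\in F \text{ for some } z\in X\}$, $E^{-1}=\{(y,x):(x,y)\in E\}$, $E^0=\Delta_X=\{(x,x):x\in X\}$, $E^{n+1}=E^n\circ E$. For maps $f,g\colon X\to Y$, $(f\times g)(E)=\{(f(x),g(y)):(x,y)\in E\}$. A coarse structure on a set $X$ is a family $\mathcal{C}_X$ of binary relations on $X$ such that $\Delta_X\in\mathcal{C}_X$; $E\subseteq F\in\mathcal{C}_X$ implies $E\in\mathcal{C}_X$; and $E,F\in\mathcal{C}_X$ implies $E\cup F, E\circ F, E^{-1}\in\mathcal{C}_X$. A set with a coarse structure is a coarse space; a pointed coarse space $(X,\xi)$ is a coarse space $X$ with a base point $\xi\in X$. A subset $A\subseteq X$ is bounded if $A\times A\in\mathcal{C}_X$; $\mathcal{B}_X$ is the family of bounded subsets. Metrics are allowed to take the value $\infty$. A metric space $(X,d)$ is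 endowed with the bounded coarse structure $\{E\subseteq X\times X : \sup d(E)<\infty\}\cup\{\varnothing\}$. $\mathbb{N}$ (containing $0$) carries its usual metric. A map $f\colon X\to Y$ between coarse spaces is proper if $f^{-1}(B)\in\mathcal{B}_X$ for all $B\in\mathcal{B}_Y$; bornologous if $(f\times f)(E)\in\mathcal{C}_Y$ for all $E\in\mathcal{C}_X$; coarse if it is proper and bornologous. A coarse map $(X,\xi)\to(Y,\eta)$ of pointed coarse spaces is a coarse map $X\to Y$ sending $\xi$ to $\eta$. $S(X,\xi)$ is the set of all coarse maps $s\colon(\mathbb{N},0)\to(X,\xi)$ (coarse sequences). For $s,t\in S(X,\xi)$ write $s\sqsubseteq^{\sigma}_{X,\xi}t$ if $s$ is a subsequence of $t$, i.e. $s=t\circ\kappa$ for some strictly increasing $\kappa\colon\mathbb{N}\to\mathbb{N}$; $\sqsupseteq^{\sigma}_{X,\xi}$ is the inverse relation. $S(X,\xi)$ is equipped with the metric $d_{S(X,\xi)}(s,t)=\inf\{n\in\mathbb{N} : (s,t)\in(\sqsubseteq^{\sigma}_{X,\xi}\cup\sqsupseteq^{\sigma}_{X,\xi})^n\}\in\mathbb{N}\cup\{\infty\}$, with $\inf\varnothing=\infty$, and with the induced bounded coarse structure. *)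

(* Defs.v *)
From mathcomp Require Import all_boot all_order all_algebra.
From mathcomp Require Import all_classical all_reals.
From mathcomp Require Import ereal.
From mathcomp Require Import lra.

Set Implicit Arguments.
Unset Strict Implicit.
Unset Printing Implicit Defensive.

Import Order.TTheory GRing.Theory Num.Theory.

Local Open Scope classical_set_scope.
Local Open Scope ring_scope.

(* The library's [B \; A] runs through [A] first; [rel_comp E F] is
   [E] first, then [F]. *)
Definition rel_comp {X : Type} (E F : set (X * X)) : set (X * X) :=
  (F \; E)%relation.

Fixpoint rel_iter {X : Type} (n : nat) (E : set (X * X)) : set (X * X) :=
  if n is n'.+1 then rel_comp (rel_iter n' E) E else diagonal.

Record is_coarse_structure {X : Type} (C : set (set (X * X))) : Prop := {
  coarse_diag : C diagonal;
  coarse_sub : forall E F : set (X * X), E `<=` F -> C F -> C E;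
  coarse_union : forall E F : set (X * X), C E -> C F -> C (E `|` F);
  coarse_comp : forall E F : set (X * X), C E -> C F -> C (rel_comp E F);
  coarse_inv : forall E : set (X * X), C E -> C (E^-1)%relation
}.

Record coarseSpace := CoarseSpace {
  coarse_carrier :> Type;
  controlled : set (set (coarse_carrier * coarse_carrier));
  controlledP : is_coarse_structure controlled
}.

Record pointedCoarseSpace := PointedCoarseSpace {
  pointed_coarse :> coarseSpace;
  basepoint : pointed_coarse
}.

Definition bounded_subset {X : coarseSpace} (A : set X) : Prop :=
  controlled (A `*` A).

Definition proper_map {X Y : coarseSpace} (f : X -> Y) : Prop :=
  forall B : set Y, bounded_subset B -> bounded_subset (f @^-1` B).

Definition bornologous {X Y : coarseSpace} (f : X -> Y) : Prop :=
  forall E : set (X * X),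
    controlled E -> controlled [set (f p.1, f p.2) | p in E].

Definition coarse_map {X Y : coarseSpace} (f : X -> Y) : Prop :=
  proper_map f /\ bornologous f.

Definition pointed_coarse_map {X Y : pointedCoarseSpace} (f : X -> Y) : Prop :=
  coarse_map f /\ f (basepoint X) = basepoint Y.

(* Metrics may take the value [+oo]. *)
Record is_emetric {R : realType} {X : Type} (d : X -> X -> \bar R) : Prop := {
  emetric_ge0 : forall x y, (0 <= d x y)%E;
  emetric_eq0 : forall x y, d x y = 0%E <-> x = y;
  emetric_sym : forall x y, d x y = d y x;
  emetric_triangle : forall x y z, (d x z <= d x y + d y z)%E
}.

Record emetricSpace (R : realType) := EmetricSpace {
  emetric_carrier :> Type;
  edistance : emetric_carrier -> emetric_carrier -> \bar R;
  edistanceP : is_emetric edistance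
}.

(* The empty relation is listed separately: its supremum in [\bar R] is
   [-oo], so that here the second disjunct is redundant. *)
Definition bounded_relations {R : realType} {X : Type} (d : X -> X -> \bar R) :
    set (set (X * X)) :=
  [set E | (ereal_sup [set d p.1 p.2 | p in E] < +oo)%E \/ E = set0].

Lemma bounded_relationsP {R : realType} {X : Type} (d : X -> X -> \bar R)
    (E : set (X * X)) :
  bounded_relations d E <->
  exists2 M : R, 0 <= M & forall p, E p -> (d p.1 p.2 <= M%:E)%E.
Proof.
split=> [[|->]|[M M0 EM]].
- case e : (ereal_sup _) => [r| |] // _.
    exists (Num.max 0 r); first by rewrite le_max lexx.
    move=> p Ep; apply: (@le_trans _ _ r%:E).
      by rewrite -e; apply: ereal_sup_ubound; exists p.
    by rewrite lee_fin le_max lexx orbT.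
  exists 0 => // p Ep; apply: (@le_trans _ _ -oo%E); last exact: leNye.
  by rewrite -e; apply: ereal_sup_ubound; exists p.
- by exists 0.
- left; apply: (@le_lt_trans _ _ M%:E); last exact: ltry.
  by apply: ge_ereal_sup => _ [p Ep <-]; exact: EM.
Qed.

Lemma bounded_relations_coarse {R : realType} {X : Type}
    (d : X -> X -> \bar R) :
  is_emetric d -> is_coarse_structure (bounded_relations d).
Proof.
move=> dP; split.
- apply/bounded_relationsP; exists 0 => // -[x y]; rewrite /diagonal /= => ->.
  by rewrite (emetric_eq0 dP y y).2.
- move=> E F EF /bounded_relationsP[M M0 FM].
  by apply/bounded_relationsP; exists M => // p /EF /FM.
- move=> E F /bounded_relationsP[M M0 EM] /bounded_relationsP[N N0 FN].
  apply/bounded_relationsP; exists (M + N); first exact: addr_ge0.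
  move=> p [/EM|/FN] /le_trans; apply; rewrite lee_fin; lra.
- move=> E F /bounded_relationsP[M M0 EM] /bounded_relationsP[N N0 FN].
  apply/bounded_relationsP; exists (M + N); first exact: addr_ge0.
  move=> [x y] [z /= /EM /= xz /FN /= zy].
  by apply: (le_trans (emetric_triangle dP x z y)); rewrite EFinD leeD.
- move=> E /bounded_relationsP[M M0 EM].
  apply/bounded_relationsP; exists M => // -[x y] /EM /=.
  by rewrite (emetric_sym dP).
Qed.

Definition bounded_coarse {R : realType} (X : emetricSpace R) : coarseSpace :=
  CoarseSpace (bounded_relations_coarse (edistanceP X)).

Definition nat_dist {R : realType} (m n : nat) : \bar R :=
  `|m%:R - n%:R|%:E.

Lemma nat_dist_emetric {R : realType} : is_emetric (@nat_dist R).
Proof.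
split.
- by move=> x y; rewrite lee_fin.
- move=> x y; split=> [[] /eqP|->]; last by rewrite /nat_dist subrr normr0.
  by rewrite normr_eq0 subr_eq0 eqr_nat => /eqP.
- by move=> x y; rewrite /nat_dist distrC.
- by move=> x y z; rewrite -EFinD lee_fin ler_distD.
Qed.

Definition pointed_nat (R : realType) : pointedCoarseSpace :=
  @PointedCoarseSpace (bounded_coarse (EmetricSpace (@nat_dist_emetric R))) 0%N.

(* [R] only serves as the value field of the metric on [nat]. *)
Record coarse_seq (R : realType) (X : pointedCoarseSpace) := CoarseSeq {
  coarse_seq_fun :> nat -> X;
  coarse_seqP : @pointed_coarse_map (pointed_nat R) X coarse_seq_fun
}.

Section SequenceSpace.
Context {R : realType} {X : pointedCoarseSpace}.
Implicit Types s t u : coarse_seq R X.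

Definition subsequence : set (coarse_seq R X * coarse_seq R X) :=
  [set p | exists kappa : nat -> nat,
     {homo kappa : m n / (m < n)%N} /\
     coarse_seq_fun p.1 = coarse_seq_fun p.2 \o kappa].

(* [ereal_inf set0 = +oo], so unrelated sequences are at distance [+oo]. *)
Definition coarse_seq_dist s t : \bar R :=
  ereal_inf [set n%:R%:E | n in
    [set n | rel_iter n (subsequence `|` (subsequence^-1)%relation) (s, t)]].

End SequenceSpace.

Lemma coarse_seq_inj (R : realType) (X : pointedCoarseSpace) :
  injective (@coarse_seq_fun R X).
Proof.
move=> [s hs] [t ht] /= st; case: _ / st ht => ht.
by rewrite (Prop_irrelevance hs ht).
Qed.

Lemma rel_iterD (X : Type) (E : set (X * X)) m n x y z :
  rel_iter m E (x, y) -> rel_iter n E (y, z) -> rel_iter (m + n) E (x, z).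
Proof.
move=> Exy; elim: n z => [|n IH] z; first by rewrite addn0 => /diagonalP <-.
by rewrite addnS => -[w /= /IH xw wz]; exists w.
Qed.

Lemma rel_iter_sym (X : Type) (E : set (X * X)) n x y :
  (forall x y, E (x, y) -> E (y, x)) ->
  rel_iter n E (x, y) -> rel_iter n E (y, x).
Proof.
move=> Es; elim: n y => [|n IH] y; first by move=> /diagonalP ->.
move=> [w /IH wx /Es yw]; rewrite -add1n.
by apply: (rel_iterD (y := w)) => //; exists y.
Qed.

Lemma coarse_seq_dist_cases (R : realType) (X : pointedCoarseSpace)
    (s t : coarse_seq R X) :
  coarse_seq_dist s t = +oo%E \/
  exists2 n : nat, coarse_seq_dist s t = n%:R%:E &
    rel_iter n (subsequence `|` (subsequence^-1)%relation) (s, t).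
Proof.
pose P n := rel_iter n (@subsequence R X `|` (subsequence^-1)%relation).
have [|noP] := pselect (exists n, `[< P n (s, t) >]); last first.
  left; rewrite /coarse_seq_dist [X in ereal_inf X](_ : _ = set0) ?ereal_inf0//.
  by rewrite -subset0 => _ [n /= Pn _]; apply: noP; exists n; exact/asboolP.
move=> exP; right; case: (ex_minnP exP) => n /asboolP Pn nmin; exists n => //.
apply/eqP; rewrite eq_le; apply/andP; split.
  by apply: ereal_inf_lbound; exists n.
apply: le_ereal_inf_tmp => _ [m /= Pm <-].
by rewrite lee_fin ler_nat; apply: nmin; exact/asboolP.
Qed.

Lemma coarse_seq_dist_le (R : realType) (X : pointedCoarseSpace)
    (s t : coarse_seq R X) n :
  rel_iter n (subsequence `|` (subsequence^-1)%relation) (s, t) ->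
  (coarse_seq_dist s t <= n%:R%:E)%E.
Proof. by move=> stn; apply: ereal_inf_lbound; exists n. Qed.

Lemma coarse_seq_dist_emetric (R : realType) (X : pointedCoarseSpace) :
  is_emetric (@coarse_seq_dist R X).
Proof.
have ge0 (s t : coarse_seq R X) : (0 <= coarse_seq_dist s t)%E.
  by case: (coarse_seq_dist_cases s t) => [->|[n -> _]]; rewrite ?leey ?lee_fin.
have symle (s t : coarse_seq R X) :
    (coarse_seq_dist s t <= coarse_seq_dist t s)%E.
  case: (coarse_seq_dist_cases t s) => [->|[n -> ts]]; first exact: leey.
  apply: coarse_seq_dist_le; apply: rel_iter_sym ts => x y.
  by case; [right|left].
split=> //.
- move=> s t; split=> [st0|->].
    case: (coarse_seq_dist_cases s t); rewrite st0 // => -[n [] /esym/eqP].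
    by rewrite pnatr_eq0 => /eqP ->.
  by apply/eqP; rewrite eq_le ge0 andbT; exact: (@coarse_seq_dist_le _ _ _ _ 0).
- by move=> s t; apply/eqP; rewrite eq_le !symle.
- move=> s t u.
  case: (coarse_seq_dist_cases s t) => [->|[m -> st]].
    by rewrite addye ?leey// -ltNye (lt_le_trans _ (ge0 t u))// ltNyr.
  case: (coarse_seq_dist_cases t u) => [->|[n -> tu]].
    by rewrite addey ?leey.
  by rewrite -EFinD -natrD; apply: coarse_seq_dist_le; exact: rel_iterD st tu.
Qed.

Definition coarse_seq_space (R : realType) (X : pointedCoarseSpace) :
    coarseSpace :=
  bounded_coarse (EmetricSpace (@coarse_seq_dist_emetric R X)).

(* Main.v *)
Require Import Defs.
From mathcomp Require Import all_boot all_order all_algebra.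
From mathcomp Require Import all_classical all_reals.

(** Coarse maps are closed under composition, so postcomposing a coarse sequence
    with a coarse map gives a coarse sequence, and functoriality is just the
    functoriality of postcomposition (a coarse sequence being determined by its
    underlying function, [coarse_seq_inj]).

    What makes the induced map bornologous is that reindexing and postcomposing
    commute: from [s = t \o kappa] follows [f \o s = (f \o t) \o kappa], so that
    [s] a subsequence of [t] makes [f \o s] a subsequence of [f \o t].  Pushing a
    zigzag of subsequences forward therefore gives a zigzag of the same length,
    and the induced map does not increase distances
    ([coarse_seq_dist_push_le]).  A map that does not increase distances sends
    relations of finite diameter to such relations ([bornologous_short]). *)

Import Order.TTheory.
Local Open Scope classical_set_scope.

Lemma pointed_coarse_map_id (X : pointedCoarseSpace) :
  pointed_coarse_map (@id X).
Proof.
split=> //; split=> [B //|E CE]; apply: (coarse_sub (controlledP X) _ CE).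
by move=> _ [[x y] Exy <-].
Qed.

Lemma pointed_coarse_map_comp {X Y Z : pointedCoarseSpace}
    {f : X -> Y} {g : Y -> Z} :
  pointed_coarse_map f -> pointed_coarse_map g -> pointed_coarse_map (g \o f).
Proof.
move=> [[fproper fborn] fbase] [[gproper gborn] gbase].
split; last by rewrite /= fbase.
split=> [B /gproper/fproper //|E /fborn/gborn].
apply: (coarse_sub (controlledP Z)) => _ [p Ep <-].
by exists (f p.1, f p.2) => //; exists p.
Qed.

Lemma rel_iter_homo {X Y : Type} {E : set (X * X)} {F : set (Y * Y)}
    {h : X -> Y} {n x y} :
  (forall x y, E (x, y) -> F (h x, h y)) ->
  rel_iter n E (x, y) -> rel_iter n F (h x, h y).
Proof.
move=> EF; elim: n y => [|n IH] y; first by move=> /diagonalP ->.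
by move=> [z /= /IH xz /EF zy]; exists (h z).
Qed.

Lemma bornologous_short {R : realType} {X Y : emetricSpace R} {h : X -> Y} :
  (forall x y, (edistance (h x) (h y) <= edistance x y)%E) ->
  @bornologous (bounded_coarse X) (bounded_coarse Y) h.
Proof.
move=> hshort E /bounded_relationsP[M M0 EM].
apply/bounded_relationsP; exists M => // _ [p /EM pM <-].
exact: le_trans (hshort _ _) pM.
Qed.

Section Push.
Context {R : realType} {X Y : pointedCoarseSpace} {f : X -> Y}.
Context (hf : pointed_coarse_map f).

Definition coarse_seq_push (s : coarse_seq R X) : coarse_seq R Y :=
  CoarseSeq (pointed_coarse_map_comp (coarse_seqP s) hf).

Lemma subsequence_push (s t : coarse_seq R X) :
  subsequence (s, t) -> subsequence (coarse_seq_push s, coarse_seq_push t).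
Proof.
by move=> [kappa [kappa_incr /= st]]; exists kappa; split; rewrite //= st.
Qed.

(** Distances are infima of lengths of zigzags of subsequences, and each zigzag
    from [s] to [t] pushes forward step by step, in either direction. *)
Lemma coarse_seq_dist_push_le (s t : coarse_seq R X) :
  (coarse_seq_dist (coarse_seq_push s) (coarse_seq_push t)
     <= coarse_seq_dist s t)%E.
Proof.
case: (coarse_seq_dist_cases s t) => [->|[n -> st]]; first exact: leey.
apply/coarse_seq_dist_le/(rel_iter_homo _ st) => u v.
by case=> /subsequence_push; [left|right].
Qed.

End Push.

Theorem theorem3p2 (R : realType) :
  exists S : forall (X Y : pointedCoarseSpace) (f : X -> Y),
      pointed_coarse_map f -> coarse_seq_space R X -> coarse_seq_space R Y,
  [/\ (forall (X Y : pointedCoarseSpace) (f : X -> Y)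
          (hf : pointed_coarse_map f) (s : coarse_seq R X),
        coarse_seq_fun (S X Y f hf s) = f \o s),
      (forall (X Y : pointedCoarseSpace) (f : X -> Y)
          (hf : pointed_coarse_map f),
        bornologous (S X Y f hf)),
      (forall X : pointedCoarseSpace,
        exists hid : pointed_coarse_map (@id X), S X X id hid = id) &
      (forall (X Y Z : pointedCoarseSpace) (f : X -> Y) (g : Y -> Z)
          (hf : pointed_coarse_map f) (hg : pointed_coarse_map g),
        exists hgf : pointed_coarse_map (g \o f),
          S X Z (g \o f) hgf = S Y Z g hg \o S X Y f hf)].
Proof.
exists (fun X Y f hf => @coarse_seq_push R X Y f hf); split=> //.
- by move=> X Y f hf; apply: bornologous_short => s t;
    exact: coarse_seq_dist_push_le.
- move=> X; exists (pointed_coarse_map_id X).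
  by apply/funext => s; exact: coarse_seq_inj.
- move=> X Y Z f g hf hg; exists (pointed_coarse_map_comp hf hg).
  by apply/funext => s; exact: coarse_seq_inj.
Qed.
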